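(* Let $F$ be a field and let $\pi=\varprojlim_i\pi_i$ be a complete profinite group (with finite quotients $\pi_i$) with surjective transition maps. Then the algebraic hull $\pi^{\mathrm{cts}}$ of $\pi$ over $F$ is isomorphic to the $F$-group scheme $$\pi_F:=\varprojlim_i(\pi_i)_F,$$ where $(\pi_i)_F$ is the constant group scheme over $F$ associated with the finite group $\pi_i$.
   Context: For a field $F$ and a topological group $G$, $\mathrm{Rep}^{\mathrm{cts}}_F(G)$ is the category of pairs $(V,\rho)$ with $V$ a finite dimensional $F$-vector space and $\rho:G\times V\to V$ an $F$-linear action that is continuous with respect to the discrete topology on $V$. The algebraic hull $G^{\mathrm{cts}}$ of $G$ over $F$ is the affine $F$-group scheme associated by Tannakian duality with the pair $(\mathrm{Rep}^{\mathrm{cts}}_F(G),\omega_G)$, where $\omega_G(V,\rho)=V$ is the forgetful functor. *)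

(* Defs.v *)
From HB Require Import structures.
From mathcomp Require Import all_boot all_order all_fingroup all_algebra.
From mathcomp Require Import boolp classical_sets topology.

Set Implicit Arguments.
Unset Strict Implicit.
Unset Printing Implicit Defensive.

Import Order.TTheory GRing.Theory.

Local Open Scope group_scope.

HB.mixin Record isTopologicalGroup G of monoid.Group G & Topological G := {
  mulg_continuous : continuous (fun x : G * G => x.1 * x.2);
  invg_continuous : continuous (fun x : G => x^-1)
}.

#[short(type="topGroupType")]
HB.structure Definition TopologicalGroup :=
  {G of isTopologicalGroup G & monoid.Group G & Topological G}.

(* Contravariant indexing: [i <= j] gives a transition map G_j -> G_i.        *)
Record inv_system (d : Order.disp_t) (I : preorderType d)
    (G : I -> groupType) := InvSystem {
  inv_tr :> forall i j, (i <= j)%O -> G j -> G i;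
  inv_trM : forall i j (le_ij : (i <= j)%O),
    {morph inv_tr le_ij : x y / x * y};
  inv_tr_id : forall i (le_ii : (i <= i)%O), inv_tr le_ii =1 id;
  inv_tr_comp : forall i j k (le_ij : (i <= j)%O) (le_jk : (j <= k)%O)
    (le_ik : (i <= k)%O), inv_tr le_ik =1 inv_tr le_ij \o inv_tr le_jk
}.

Record inv_lim d (I : preorderType d) (G : I -> groupType)
    (t : inv_system G) := InvLim {
  lim_val :> forall i, G i;
  lim_tr : forall i j (le_ij : (i <= j)%O),
    inv_tr t le_ij (lim_val j) = lim_val i
}.

Section InvLimGroup.
Variables (d : Order.disp_t) (I : preorderType d) (G : I -> groupType).
Variable (t : inv_system G).
Implicit Types x y z : inv_lim t.

Lemma inv_lim_ext x y : (forall i, x i = y i) -> x = y.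
Proof.
case: x y => [x xP] [y yP] /= e.
have exy : x = y by exact: functional_extensionality_dep.
by case: _ / exy yP => yP; congr InvLim; exact: Prop_irrelevance.
Qed.

Lemma inv_tr1 i j (le_ij : (i <= j)%O) : inv_tr t le_ij 1 = 1.
Proof. by apply: (mulgI (inv_tr t le_ij 1)); rewrite -inv_trM !mulg1. Qed.

Lemma inv_trV i j (le_ij : (i <= j)%O) (x : G j) :
  inv_tr t le_ij x^-1 = (inv_tr t le_ij x)^-1.
Proof.
by apply: (mulgI (inv_tr t le_ij x)); rewrite -inv_trM !mulgV inv_tr1.
Qed.

Definition inv_lim_one : inv_lim t := InvLim inv_tr1.

Lemma inv_lim_mulP x y i j (le_ij : (i <= j)%O) :
  inv_tr t le_ij (x j * y j) = x i * y i.
Proof. by rewrite inv_trM !lim_tr. Qed.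
Definition inv_lim_mul x y : inv_lim t := InvLim (inv_lim_mulP x y).

Lemma inv_lim_invP x i j (le_ij : (i <= j)%O) :
  inv_tr t le_ij (x j)^-1 = (x i)^-1.
Proof. by rewrite inv_trV !lim_tr. Qed.
Definition inv_lim_inv x : inv_lim t := InvLim (inv_lim_invP x).

HB.instance Definition _ := gen_eqMixin (inv_lim t).
HB.instance Definition _ := gen_choiceMixin (inv_lim t).

Lemma inv_lim_mulA : associative inv_lim_mul.
Proof. by move=> x y z; apply: inv_lim_ext => i; exact: mulgA. Qed.
Lemma inv_lim_mul1 : left_id inv_lim_one inv_lim_mul.
Proof. by move=> x; apply: inv_lim_ext => i; exact: mul1g. Qed.
Lemma inv_lim_mulr1 : right_id inv_lim_one inv_lim_mul.
Proof. by move=> x; apply: inv_lim_ext => i; exact: mulg1. Qed.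
Lemma inv_lim_mulV : left_inverse inv_lim_one inv_lim_inv inv_lim_mul.
Proof. by move=> x; apply: inv_lim_ext => i; exact: mulVg. Qed.
Lemma inv_lim_mulrV : right_inverse inv_lim_one inv_lim_inv inv_lim_mul.
Proof. by move=> x; apply: inv_lim_ext => i; exact: mulgV. Qed.

HB.instance Definition _ := isGroup.Build (inv_lim t)
  inv_lim_mulA inv_lim_mul1 inv_lim_mulr1 inv_lim_mulV inv_lim_mulrV.

End InvLimGroup.

Definition profinite d (I : preorderType d) (P : I -> finGroupType)
  (t : inv_system (fun i => P i)) : Type := inv_lim t.

Section Profinite.
Variables (d : Order.disp_t) (I : preorderType d) (P : I -> finGroupType).
Variable (t : inv_system (fun i => P i)).

Definition profinite_val (x : profinite t) :
  prod_topology (fun i => discrete_topology (P i)) := lim_val x.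

HB.instance Definition _ := monoid.Group.on (profinite t).
HB.instance Definition _ :=
  Topological.copy (profinite t) (initial_topology profinite_val).

Lemma profinite_near (x : profinite t) i :
  \forall y \near x, profinite_val y i = profinite_val x i.
Proof.
have /(_ x) cv := @initial_continuous _ _ profinite_val.
have cp := @proj_continuous I (fun i => discrete_topology (P i)) i
  (profinite_val x).
exact: (cvg_comp _ _ cv cp _ (discrete_set1 _)).
Qed.

Lemma profinite_continuous (T : topologicalType) (f : T -> profinite t) :
  (forall x i, \forall y \near x,
     profinite_val (f y) i = profinite_val (f x) i) -> continuous f.
Proof.
move=> fP; apply: continuous_comp_initial => x; apply/cvg_sup => i U.
case=> V [[W _ <-] Wx VU]; apply: filterS (fP x i) => y /= e; apply: VU.
by rewrite /= e.
Qed.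

Lemma profinite_mul_continuous :
  continuous (fun x : profinite t * profinite t => x.1 * x.2).
Proof.
apply: profinite_continuous => -[x y] i /=.
exists ([set u | profinite_val u i = profinite_val x i],
        [set u | profinite_val u i = profinite_val y i])%classic => /=.
  by split; exact: profinite_near.
by move=> [u v] [/= eu ev]; rewrite /profinite_val /= in eu ev *; rewrite eu ev.
Qed.

Lemma profinite_inv_continuous : continuous (fun x : profinite t => x^-1).
Proof.
apply: profinite_continuous => x i; apply: filterS (profinite_near x i) => y.
by rewrite /profinite_val /= => ->.
Qed.

HB.instance Definition _ := isTopologicalGroup.Build (profinite t)
  profinite_mul_continuous profinite_inv_continuous.

End Profinite.


Local Close Scope group_scope.
Local Open Scope ring_scope.

(* An F-group scheme is given by its functor of points. Since [comAlgType]    *)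
(* excludes the zero algebra, so do these functors; every group scheme has a  *)
(* single point over it, hence morphisms are unaffected. The group laws are   *)
(* fields, not a [groupType], because the points of a Tannakian group are     *)
(* families indexed by all representations and live in a larger universe.     *)
Record grp_functor (F : fieldType) := GrpFunctor {
  gf_ob :> comAlgType F -> Type;
  gf_one : forall R, gf_ob R;
  gf_mul : forall R, gf_ob R -> gf_ob R -> gf_ob R;
  gf_inv : forall R, gf_ob R -> gf_ob R;
  gf_mulA : forall R, associative (@gf_mul R);
  gf_mul1g : forall R, left_id (gf_one R) (@gf_mul R);
  gf_mulVg : forall R, left_inverse (gf_one R) (@gf_inv R) (@gf_mul R);
  gf_map : forall R S : comAlgType F, {lrmorphism R -> S} ->
    gf_ob R -> gf_ob S;
  gf_mapM : forall (R S : comAlgType F) (f : {lrmorphism R -> S}),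
    {morph gf_map f : x y / gf_mul x y};
  gf_map_id : forall (R : comAlgType F) (f : {lrmorphism R -> R}),
    f =1 id -> gf_map f =1 id;
  gf_map_comp : forall (R S T : comAlgType F) (f : {lrmorphism R -> S})
    (g : {lrmorphism S -> T}) (h : {lrmorphism R -> T}),
    h =1 g \o f -> gf_map h =1 gf_map g \o gf_map f
}.

Record gf_hom (F : fieldType) (G H : grp_functor F) := GfHom {
  gf_fun :> forall R : comAlgType F, G R -> H R;
  gf_funM : forall R : comAlgType F,
    {morph @gf_fun R : x y / gf_mul x y};
  gf_nat : forall (R S : comAlgType F) (f : {lrmorphism R -> S}) (x : G R),
    gf_fun (gf_map f x) = gf_map f (gf_fun x)
}.
Arguments gf_fun {F G H} _ R _.

Definition gf_isomorphic (F : fieldType) (G H : grp_functor F) : Prop :=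
  exists phi : gf_hom G H, forall R, bijective (phi R).

Record gf_system (F : fieldType) d (I : preorderType d)
    (G : I -> grp_functor F) := GfSystem {
  gf_tr :> forall i j, (i <= j)%O -> gf_hom (G j) (G i);
  gf_tr_id : forall i (le_ii : (i <= i)%O) R, gf_tr le_ii R =1 id;
  gf_tr_comp : forall i j k (le_ij : (i <= j)%O) (le_jk : (j <= k)%O)
    (le_ik : (i <= k)%O) R, gf_tr le_ik R =1 gf_tr le_ij R \o gf_tr le_jk R
}.

(* Limits of group schemes are computed pointwise on the functors of points.  *)
Section GfLim.
Variables (F : fieldType) (d : Order.disp_t) (I : preorderType d).
Variables (G : I -> grp_functor F) (t : gf_system G).

Record gf_lim_ob (R : comAlgType F) := GfLimOb {
  gf_lim_val :> forall i, G i R;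
  gf_lim_tr : forall i j (le_ij : (i <= j)%O),
    gf_tr t le_ij R (gf_lim_val j) = gf_lim_val i
}.

Lemma gf_lim_ext R (x y : gf_lim_ob R) : (forall i, x i = y i) -> x = y.
Proof.
case: x y => [x xP] [y yP] /= e.
have exy : x = y by exact: functional_extensionality_dep.
by case: _ / exy yP => yP; congr GfLimOb; exact: Prop_irrelevance.
Qed.

Lemma gf_mulI (H : grp_functor F) R (x y z : H R) :
  gf_mul x y = gf_mul x z -> y = z.
Proof.
by move=> e; rewrite -[y]gf_mul1g -[z]gf_mul1g -(gf_mulVg x) -!gf_mulA e.
Qed.

Lemma gf_mulg1 (H : grp_functor F) R (x : H R) : gf_mul x (gf_one H R) = x.
Proof.
by apply: (@gf_mulI H R (gf_inv x)); rewrite gf_mulA gf_mulVg gf_mul1g.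
Qed.

Lemma gf_hom1 (H K : grp_functor F) (f : gf_hom H K) R :
  f R (gf_one H R) = gf_one K R.
Proof.
apply: (@gf_mulI K R (f R (gf_one H R))).
by rewrite -gf_funM !gf_mulg1.
Qed.

Lemma gf_mulgV (H : grp_functor F) R (x : H R) :
  gf_mul x (gf_inv x) = gf_one H R.
Proof.
by apply: (@gf_mulI H R (gf_inv x)); rewrite gf_mulA gf_mulVg gf_mul1g gf_mulg1.
Qed.

Lemma gf_homV (H K : grp_functor F) (f : gf_hom H K) R (x : H R) :
  f R (gf_inv x) = gf_inv (f R x).
Proof.
rewrite -[LHS]gf_mulg1 -(gf_mulgV (f R x)) gf_mulA -gf_funM gf_mulVg gf_hom1.
by rewrite gf_mul1g.
Qed.

Lemma gf_lim_oneP R i j (le_ij : (i <= j)%O) :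
  gf_tr t le_ij R (gf_one (G j) R) = gf_one (G i) R.
Proof. exact: gf_hom1. Qed.
Definition gf_lim_one R : gf_lim_ob R := GfLimOb (@gf_lim_oneP R).

Lemma gf_lim_mulP R (x y : gf_lim_ob R) i j (le_ij : (i <= j)%O) :
  gf_tr t le_ij R (gf_mul (x j) (y j)) = gf_mul (x i) (y i).
Proof. by rewrite gf_funM !gf_lim_tr. Qed.
Definition gf_lim_mul R (x y : gf_lim_ob R) : gf_lim_ob R :=
  GfLimOb (gf_lim_mulP x y).

Lemma gf_lim_invP R (x : gf_lim_ob R) i j (le_ij : (i <= j)%O) :
  gf_tr t le_ij R (gf_inv (x j)) = gf_inv (x i).
Proof. by rewrite gf_homV gf_lim_tr. Qed.
Definition gf_lim_inv R (x : gf_lim_ob R) : gf_lim_ob R :=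
  GfLimOb (gf_lim_invP x).

Lemma gf_lim_mapP (R S : comAlgType F) (f : {lrmorphism R -> S})
    (x : gf_lim_ob R) i j (le_ij : (i <= j)%O) :
  gf_tr t le_ij S (gf_map f (x j)) = gf_map f (x i).
Proof. by rewrite gf_nat gf_lim_tr. Qed.
Definition gf_lim_map (R S : comAlgType F) (f : {lrmorphism R -> S})
  (x : gf_lim_ob R) : gf_lim_ob S := GfLimOb (gf_lim_mapP f x).

Lemma gf_lim_mulA R : associative (@gf_lim_mul R).
Proof. by move=> x y z; apply: gf_lim_ext => i; exact: gf_mulA. Qed.
Lemma gf_lim_mul1g R : left_id (gf_lim_one R) (@gf_lim_mul R).
Proof. by move=> x; apply: gf_lim_ext => i; exact: gf_mul1g. Qed.
Lemma gf_lim_mulVg R :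
  left_inverse (gf_lim_one R) (@gf_lim_inv R) (@gf_lim_mul R).
Proof. by move=> x; apply: gf_lim_ext => i; exact: gf_mulVg. Qed.
Lemma gf_lim_mapM (R S : comAlgType F) (f : {lrmorphism R -> S}) :
  {morph gf_lim_map f : x y / gf_lim_mul x y}.
Proof. by move=> x y; apply: gf_lim_ext => i; exact: gf_mapM. Qed.
Lemma gf_lim_map_id (R : comAlgType F) (f : {lrmorphism R -> R}) :
  f =1 id -> gf_lim_map f =1 id.
Proof. by move=> f1 x; apply: gf_lim_ext => i; exact: gf_map_id. Qed.
Lemma gf_lim_map_comp (R S T : comAlgType F) (f : {lrmorphism R -> S})
    (g : {lrmorphism S -> T}) (h : {lrmorphism R -> T}) :
  h =1 g \o f -> gf_lim_map h =1 gf_lim_map g \o gf_lim_map f.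
Proof. by move=> hE x; apply: gf_lim_ext => i; exact: gf_map_comp. Qed.

Definition gf_lim : grp_functor F :=
  GrpFunctor gf_lim_mulA gf_lim_mul1g gf_lim_mulVg gf_lim_mapM gf_lim_map_id
    gf_lim_map_comp.

End GfLim.

Section ConstantGroup.
Variables (F : fieldType) (Gamma : finGroupType).

(* The constant group scheme is Spec of the Hopf algebra F^Gamma of functions *)
(* Gamma -> F, so its R-points are the F-algebra morphisms F^Gamma -> R.      *)
Record const_ob (R : comAlgType F) := ConstOb {
  co_fun :> {ffun Gamma -> F^o} -> R;
  co_linear : linear co_fun;
  co1 : co_fun 1 = 1;
  coM : {morph co_fun : a b / a * b}
}.

Definition ffdelta (g : Gamma) : {ffun Gamma -> F^o} := [ffun h => (h == g)%:R].

Section Points.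
Variable R : comAlgType F.
Implicit Types x y z : const_ob R.

HB.instance Definition _ x :=
  GRing.isLinear.Build F {ffun Gamma -> F^o} R _ (co_fun x) (@co_linear R x).

Lemma ffdelta_sum (a : {ffun Gamma -> F^o}) : a = \sum_g a g *: ffdelta g.
Proof.
apply/ffunP => h; rewrite sum_ffunE (bigD1 h) //= !ffunE eqxx [_ *: _]mulr1.
rewrite big1 ?addr0 // => g /negbTE gh.
by rewrite !ffunE eq_sym gh scaler0.
Qed.

Lemma ffdeltaM g h : ffdelta g * ffdelta h = (g == h)%:R *: ffdelta g.
Proof.
apply/ffunP => k; rewrite !ffunE; have [->|kg] := eqVneq k g.
  by rewrite mul1r [_ *: _]mulr1.
by rewrite mul0r scaler0.
Qed.

Lemma coE x a : x a = \sum_g a g *: x (ffdelta g).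
Proof.
by rewrite {1}[a]ffdelta_sum linear_sum; apply: eq_bigr => g _; rewrite linearZ.
Qed.

Lemma co_deltaM x g h : x (ffdelta g) * x (ffdelta h) =
  (g == h)%:R *: x (ffdelta g).
Proof. by rewrite -coM ffdeltaM linearZ. Qed.

Lemma co_delta_sum x : \sum_g x (ffdelta g) = 1.
Proof.
rewrite -[RHS](co1 x) [RHS]coE; apply: eq_bigr => g _.
by rewrite ffunE scale1r.
Qed.

Lemma const_ob_ext x y : (forall g, x (ffdelta g) = y (ffdelta g)) -> x = y.
Proof.
move=> e; have {e} : co_fun x = co_fun y.
  by apply: funext => a; rewrite coE [RHS]coE; apply: eq_bigr => g _; rewrite e.
case: x y => [x xl x1 xM] [y yl y1 yM] /= exy.
by case: _ / exy yl y1 yM => *; congr ConstOb; exact: Prop_irrelevance.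
Qed.

(* The product of points is dual to the comultiplication                      *)
(* [a |-> ((g, h) |-> a (g * h))] of F^Gamma, expanded on the basis           *)
(* [ffdelta g] (x) [ffdelta h] of F^Gamma (x) F^Gamma; the unit and inverse   *)
(* are dual to the counit and antipode.                                       *)
Definition const_mul_fun x y (a : {ffun Gamma -> F^o}) : R :=
  \sum_g \sum_h a (g * h)%g *: (x (ffdelta g) * y (ffdelta h)).
Definition const_one_fun (a : {ffun Gamma -> F^o}) : R := (a 1%g)%:A.
Definition const_inv_fun x (a : {ffun Gamma -> F^o}) : R :=
  x [ffun g => a g^-1%g].

Lemma const_mul_linear x y : linear (const_mul_fun x y).
Proof.
move=> k a b; rewrite /const_mul_fun scaler_sumr -big_split /=.
apply: eq_bigr => g _; rewrite scaler_sumr -big_split /=.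
apply: eq_bigr => h _; rewrite !ffunE scalerDl scalerA; congr (_ *: _ + _).
Qed.
Lemma const_mul1 x y : const_mul_fun x y 1 = 1.
Proof.
rewrite /const_mul_fun -[RHS]mulr1 -{1}(co_delta_sum x) -(co_delta_sum y).
rewrite mulr_suml; apply: eq_bigr => g _; rewrite mulr_sumr.
by apply: eq_bigr => h _; rewrite ffunE scale1r.
Qed.
Lemma const_mulM x y : {morph const_mul_fun x y : a b / a * b}.
Proof.
move=> a b; rewrite /const_mul_fun mulr_suml; apply: eq_bigr => g _.
rewrite mulr_suml; apply: eq_bigr => h _.
rewrite mulr_sumr (bigD1 g) //= [X in _ + X]big1 ?addr0; last first.
  move=> g' /negbTE gg'; rewrite mulr_sumr big1 // => h' _.
  rewrite -scalerAl -scalerAr mulrACA co_deltaM eq_sym gg' scale0r mul0r.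
  by rewrite !scaler0.
rewrite mulr_sumr (bigD1 h) //= [X in _ + X]big1 ?addr0; last first.
  move=> h' /negbTE hh'.
  rewrite -scalerAl -scalerAr mulrACA !co_deltaM [h == _]eq_sym hh' scale0r.
  by rewrite mulr0 !scaler0.
rewrite -scalerAl -scalerAr mulrACA !co_deltaM !eqxx !scale1r scalerA.
by rewrite ffunE.
Qed.
Definition const_mul x y : const_ob R :=
  ConstOb (const_mul_linear x y) (const_mul1 x y) (const_mulM x y).

Lemma const_one_linear : linear const_one_fun.
Proof.
by move=> k a b; rewrite /const_one_fun !ffunE scalerDl scalerA.
Qed.
Lemma const_one1 : const_one_fun 1 = 1.
Proof. by rewrite /const_one_fun ffunE scale1r. Qed.
Lemma const_oneM : {morph const_one_fun : a b / a * b}.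
Proof.
by move=> a b; rewrite /const_one_fun ffunE -scalerAl mul1r scalerA.
Qed.
Definition const_one : const_ob R :=
  ConstOb const_one_linear const_one1 const_oneM.

Lemma const_inv_linear x : linear (const_inv_fun x).
Proof.
move=> k a b; rewrite /const_inv_fun -co_linear; congr (x _).
by apply/ffunP => g; rewrite !ffunE.
Qed.
Lemma const_inv1 x : const_inv_fun x 1 = 1.
Proof.
rewrite /const_inv_fun -[RHS](co1 x); congr (x _).
by apply/ffunP => g; rewrite !ffunE.
Qed.
Lemma const_invM x : {morph const_inv_fun x : a b / a * b}.
Proof.
move=> a b; rewrite /const_inv_fun -coM; congr (x _).
by apply/ffunP => g; rewrite !ffunE.
Qed.
Definition const_inv x : const_ob R :=
  ConstOb (const_inv_linear x) (const_inv1 x) (const_invM x).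

Lemma const_mulE x y k : const_mul x y (ffdelta k) =
  \sum_g x (ffdelta g) * y (ffdelta (g^-1 * k)%g).
Proof.
rewrite /= /const_mul_fun; apply: eq_bigr => g _.
rewrite (bigD1 (g^-1 * k)%g) //= ffunE mulKVg eqxx scale1r.
rewrite big1 ?addr0 // => h /negbTE hk; rewrite ffunE.
by rewrite (can2_eq (mulKg g) (mulKVg g)) hk scale0r.
Qed.

Lemma const_mulA : associative const_mul.
Proof.
move=> x y z; apply: const_ob_ext => k; rewrite !const_mulE.
transitivity (\sum_g \sum_m x (ffdelta g) *
    (y (ffdelta (g^-1 * m)%g) * z (ffdelta (m^-1 * k)%g))); last first.
  rewrite exchange_big; apply: eq_bigr => m _; rewrite const_mulE mulr_suml.
  by apply: eq_bigr => g _; rewrite mulrA.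
apply: eq_bigr => g _; rewrite const_mulE mulr_sumr.
rewrite (reindex_inj (mulgI g^-1%g)) /=; apply: eq_bigr => m _.
by rewrite invMg invgK -mulgA mulKVg.
Qed.

Lemma const_mul1g : left_id const_one const_mul.
Proof.
move=> x; apply: const_ob_ext => k; rewrite const_mulE (bigD1 1%g) //=.
rewrite /const_one_fun ffunE eqxx invg1 mul1g !scale1r mul1r big1 ?addr0 //.
by move=> g /negbTE g1; rewrite ffunE eq_sym g1 scale0r mul0r.
Qed.

Lemma const_mulVg : left_inverse const_one const_inv const_mul.
Proof.
move=> x; apply: const_ob_ext => k; rewrite const_mulE /=.
have dV g : [ffun h => ffdelta g h^-1%g] = ffdelta g^-1%g.
  by apply/ffunP => h; rewrite !ffunE (can2_eq (@invgK _) (@invgK _)).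
under eq_bigr => g _ do rewrite /const_inv_fun dV co_deltaM.
rewrite /const_one_fun ffunE -(co_delta_sum x) scaler_sumr.
rewrite (reindex_inj invg_inj) /=; apply: eq_bigr => g _.
rewrite !invgK; congr (_%:R *: _); congr nat_of_bool.
by rewrite -{1}[g]mulg1 (inj_eq (mulgI g)).
Qed.

End Points.

Section Functor.
Variables (R S : comAlgType F) (f : {lrmorphism R -> S}).
Implicit Types x y : const_ob R.

Lemma const_map_linear x : linear (f \o x).
Proof. by move=> k a b; rewrite /= co_linear linearP. Qed.
Lemma const_map1 x : (f \o x) 1 = 1.
Proof. by rewrite /= co1 rmorph1. Qed.
Lemma const_mapM x : {morph f \o x : a b / a * b}.
Proof. by move=> a b; rewrite /= coM rmorphM. Qed.
Definition const_map x : const_ob S :=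
  ConstOb (const_map_linear x) (const_map1 x) (const_mapM x).

Lemma const_map_mul : {morph const_map : x y / const_mul x y}.
Proof.
move=> x y; apply: const_ob_ext => k; rewrite const_mulE [LHS]/=.
rewrite -[const_mul_fun _ _ _]/(const_mul x y (ffdelta k)) const_mulE.
by rewrite rmorph_sum; apply: eq_bigr => g _; rewrite rmorphM.
Qed.
End Functor.

Lemma const_map_id (R : comAlgType F) (f : {lrmorphism R -> R}) :
  f =1 id -> const_map f =1 id.
Proof. by move=> f1 x; apply: const_ob_ext => g; rewrite /= f1. Qed.
Lemma const_map_comp (R S T : comAlgType F) (f : {lrmorphism R -> S})
    (g : {lrmorphism S -> T}) (h : {lrmorphism R -> T}) :
  h =1 g \o f -> const_map h =1 const_map g \o const_map f.
Proof. by move=> hE x; apply: const_ob_ext => k; rewrite /= hE. Qed.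

Definition const_gf : grp_functor F :=
  GrpFunctor const_mulA const_mul1g const_mulVg const_map_mul const_map_id
    const_map_comp.

End ConstantGroup.

Section ConstantHom.
Variables (F : fieldType) (A B : finGroupType) (p : A -> B).
Hypothesis pM : {morph p : g h / (g * h)%g}.

Definition ffpull (a : {ffun B -> F^o}) : {ffun A -> F^o} :=
  [ffun g => a (p g)].

Section Points.
Variable R : comAlgType F.
Implicit Type x : const_ob A R.
Lemma const_push_linear x : linear (x \o ffpull).
Proof.
move=> k a b; rewrite /= -co_linear; congr (x _).
by apply/ffunP => g; rewrite !ffunE.
Qed.
Lemma const_push1 x : (x \o ffpull) 1 = 1.
Proof.
by rewrite /= -(co1 x); congr (x _); apply/ffunP => g; rewrite !ffunE.
Qed.
Lemma const_pushM x : {morph x \o ffpull : a b / a * b}.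
Proof.
move=> a b; rewrite /= -coM; congr (x _).
by apply/ffunP => g; rewrite !ffunE.
Qed.
Definition const_push x : const_ob B R :=
  ConstOb (const_push_linear x) (const_push1 x) (const_pushM x).

Lemma const_push_sum x (c : B -> R) :
  \sum_b c b * x (ffpull (ffdelta F b)) = \sum_g c (p g) * x (ffdelta F g).
Proof.
under eq_bigr => b _ do rewrite coE mulr_sumr.
rewrite exchange_big; apply: eq_bigr => g _ /=.
rewrite (bigD1 (p g)) //= !ffunE eqxx scale1r big1 ?addr0 // => b /negbTE bg.
by rewrite !ffunE eq_sym bg scale0r mulr0.
Qed.

Lemma const_push_mul :
  {morph const_push : x y / const_mul x y}.
Proof.
move=> x y; apply: const_ob_ext => k; rewrite [RHS]/= /const_mul_fun /=.
transitivity (\sum_b (\sum_c (ffdelta F k (b * c)%g)%:A *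
    y (ffpull (ffdelta F c))) * x (ffpull (ffdelta F b))); last first.
  apply: eq_bigr => b _; rewrite mulr_suml; apply: eq_bigr => c _.
  by rewrite -!scalerAl mul1r mulrC.
rewrite (const_push_sum x) /= /const_mul_fun; apply: eq_bigr => g _.
rewrite (const_push_sum y (fun c => (ffdelta F k (p g * c)%g)%:A)) mulr_suml.
apply: eq_bigr => h _; rewrite -!scalerAl mul1r mulrC.
by congr (_ *: _); rewrite !ffunE pM.
Qed.
End Points.

Lemma const_push_nat (R S : comAlgType F) (f : {lrmorphism R -> S})
  (x : const_gf F A R) :
  const_push (gf_map f x) = gf_map f (const_push x : const_gf F B R).
Proof. by apply: const_ob_ext. Qed.

Definition const_hom : gf_hom (const_gf F A) (const_gf F B) :=
  @GfHom F (const_gf F A) (const_gf F B) const_push const_push_mul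
    const_push_nat.

End ConstantHom.

Section ConstantSystem.
Variables (F : fieldType) (d : Order.disp_t) (I : preorderType d).
Variables (P : I -> finGroupType) (t : inv_system (fun i => P i)).

Lemma const_sys_id i (le_ii : (i <= i)%O) R :
  const_hom F (@inv_trM _ _ _ t i i le_ii) R =1 id.
Proof.
move=> x; apply: const_ob_ext => g /=; congr (co_fun x _).
by apply/ffunP => h; rewrite !ffunE inv_tr_id.
Qed.
Lemma const_sys_comp i j k (le_ij : (i <= j)%O) (le_jk : (j <= k)%O)
    (le_ik : (i <= k)%O) R :
  const_hom F (@inv_trM _ _ _ t _ _ le_ik) R =1
    const_hom F (@inv_trM _ _ _ t _ _ le_ij) R \o
    const_hom F (@inv_trM _ _ _ t _ _ le_jk) R.
Proof.
move=> x; apply: const_ob_ext => g /=; congr (co_fun x _).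
by apply/ffunP => h; rewrite !ffunE (inv_tr_comp t le_ij le_jk).
Qed.
Definition const_system : gf_system (fun i => const_gf F (P i)) :=
  GfSystem const_sys_id const_sys_comp.

End ConstantSystem.

(* V (x) W is modelled on the basis of tensors of basis vectors; [tens_univ]  *)
(* is its universal property. The scalar extension V_R of V is modelled by    *)
(* the column vectors over R in the basis [vbasis {: V}]: [ext_vec v] is      *)
(* v (x) 1, [ext_map f] is the matrix of f (x) 1, and [ext_tens x y] is the   *)
(* image of x (x) y under V_R (x)_R W_R = (V (x) W)_R.                        *)
Section FiniteDimensional.
Variable F : fieldType.
Implicit Types V W U : vectType F.

Definition lmx V W (f : 'Hom(V, W)) : 'M[F]_(\dim {: W}, \dim {: V}) :=
  \matrix_(i, j) coord (vbasis {: W}) i (f (vbasis {: V})`_j).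

Definition tens V W : vectType F := 'M[F]_(\dim {: V}, \dim {: W}).

Definition ptens V W (v : V) (w : W) : tens V W :=
  \matrix_(i, j) (coord (vbasis {: V}) i v * coord (vbasis {: W}) j w).

Definition tens_map V V' W W' (f : 'Hom(V, V')) (g : 'Hom(W, W')) :
  'Hom(tens V W, tens V' W') :=
  linfun (fun M => lmx f *m M *m (lmx g)^T).

Lemma lmx_coord V W (f : 'Hom(V, W)) v i :
  coord (vbasis {: W}) i (f v) =
  \sum_j lmx f i j * coord (vbasis {: V}) j v.
Proof.
rewrite {1}(coord_vbasis (memvf v)) linear_sum linear_sum.
by apply: eq_bigr => j _; rewrite !linearZ mxE mulrC.
Qed.

Lemma tens_map_linear V V' W W' (f : 'Hom(V, V')) (g : 'Hom(W, W')) :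
  linear (fun M : tens V W => lmx f *m M *m (lmx g)^T : tens V' W').
Proof. by move=> k M N; rewrite mulmxDr mulmxDl -scalemxAr -scalemxAl. Qed.

Lemma tens_mapE V V' W W' (f : 'Hom(V, V')) (g : 'Hom(W, W')) M :
  tens_map f g M = lmx f *m M *m (lmx g)^T.
Proof.
pose h := GRing.isLinear.Build F (tens V W) (tens V' W') _ _
  (tens_map_linear f g).
pose hL : {linear tens V W -> tens V' W'} :=
  HB.pack (fun M : tens V W => lmx f *m M *m (lmx g)^T : tens V' W') h.
exact: (lfunE hL M).
Qed.

Lemma tens_map_ptens V V' W W' (f : 'Hom(V, V')) (g : 'Hom(W, W')) v w :
  tens_map f g (ptens v w) = ptens (f v) (g w).
Proof.
rewrite tens_mapE; apply/matrixP => i j; rewrite !mxE.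
rewrite (lmx_coord g w) mulr_sumr; apply: eq_bigr => k _.
rewrite !mxE (lmx_coord f v) !mulr_suml; apply: eq_bigr => l _.
by rewrite !mxE mulrA -!mulrA; congr (_ * (_ * _)); rewrite mulrC.
Qed.

Lemma coord_basis_delta V (j k : 'I_(\dim {: V})) :
  coord (vbasis {: V}) k (vbasis {: V})`_j = (k == j)%:R.
Proof. by rewrite (coord_free _ _ (basis_free (vbasisP _))) eq_sym. Qed.

Lemma lmx1 V : lmx \1%VF = 1%:M :> 'M[F]_(\dim {: V}).
Proof. by apply/matrixP => i j; rewrite !mxE id_lfunE coord_basis_delta. Qed.

Lemma lmxM V W U (f : 'Hom(W, U)) (g : 'Hom(V, W)) :
  lmx (f \o g)%VF = lmx f *m lmx g.
Proof.
apply/matrixP => i j; rewrite !mxE comp_lfunE lmx_coord.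
by apply: eq_bigr => k _; rewrite [lmx g _ _]mxE.
Qed.

Lemma ptens_basis V W (i : 'I_(\dim {: V})) (j : 'I_(\dim {: W})) :
  ptens (vbasis {: V})`_i (vbasis {: W})`_j = delta_mx i j.
Proof.
apply/matrixP => k l; rewrite !mxE !coord_basis_delta.
by case: (k == i); case: (l == j); rewrite ?mul1r ?mul0r.
Qed.

Lemma tens_univ V W U (b : V -> W -> U) :
  (forall w, linear (b^~ w)) -> (forall v, linear (b v)) ->
  exists! f : 'Hom(tens V W, U), forall v w, f (ptens v w) = b v w.
Proof.
move=> bl br.
have blS w n (k : 'I_n -> F) (e : 'I_n -> V) :
    b (\sum_i k i *: e i) w = \sum_i k i *: b (e i) w.
  pose L : {linear V -> U} := HB.pack (b^~ w)
    (GRing.isLinear.Build F V U _ _ (bl w)).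
  by rewrite -[LHS]/(L _) linear_sum; apply: eq_bigr => i _; rewrite linearZ.
have brS v n (k : 'I_n -> F) (e : 'I_n -> W) :
    b v (\sum_i k i *: e i) = \sum_i k i *: b v (e i).
  pose L : {linear W -> U} := HB.pack (b v)
    (GRing.isLinear.Build F W U _ _ (br v)).
  by rewrite -[LHS]/(L _) linear_sum; apply: eq_bigr => i _; rewrite linearZ.
pose f0 (M : tens V W) : U :=
  \sum_i \sum_j M i j *: b (vbasis {: V})`_i (vbasis {: W})`_j.
have f0_linear : linear f0.
  move=> k M N; rewrite /f0 scaler_sumr -big_split; apply: eq_bigr => i _.
  rewrite scaler_sumr -big_split; apply: eq_bigr => j _ /=.
  by rewrite !mxE scalerDl scalerA.
pose f0L : {linear tens V W -> U} :=
  HB.pack f0 (GRing.isLinear.Build F (tens V W) U _ _ f0_linear).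
exists (linfun f0L); split=> [v w|f fP].
  rewrite lfunE /= /f0 [in RHS](coord_vbasis (memvf v)).
  rewrite [in RHS](coord_vbasis (memvf w)) blS; apply: eq_bigr => i _.
  rewrite brS scaler_sumr; apply: eq_bigr => j _.
  by rewrite mxE scalerA.
apply/lfunP => M; rewrite lfunE /= /f0 [in RHS](matrix_sum_delta M) linear_sum.
apply: eq_bigr => i _; rewrite linear_sum; apply: eq_bigr => j _.
by rewrite linearZ /= -fP ptens_basis.
Qed.

Section Extension.
Variable R : comAlgType F.

Definition ext_vec V (v : V) : 'cV[R]_(\dim {: V}) :=
  \col_i (coord (vbasis {: V}) i v)%:A.

Definition ext_map V W (f : 'Hom(V, W)) : 'M[R]_(\dim {: W}, \dim {: V}) :=
  map_mx (in_alg R) (lmx f).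

Definition ext_tens V W (x : 'cV[R]_(\dim {: V})) (y : 'cV[R]_(\dim {: W})) :
    'cV[R]_(\dim {: tens V W}) :=
  \sum_i \sum_j (x i 0 * y j 0) *:
    ext_vec (ptens (vbasis {: V})`_i (vbasis {: W})`_j).

Lemma ext_tens_suml V W n (k : 'I_n -> R) (e : 'I_n -> 'cV[R]_(\dim {: V}))
    (y : 'cV[R]_(\dim {: W})) :
  ext_tens (\sum_i k i *: e i) y = \sum_i k i *: ext_tens (e i) y.
Proof.
have lx : linear (@ext_tens V W ^~ y).
  move=> c u v; rewrite /ext_tens scaler_sumr -big_split.
  apply: eq_bigr => i _; rewrite scaler_sumr -big_split.
  by apply: eq_bigr => j _ /=; rewrite !mxE scalerA -scalerDl mulrDl mulrA.
pose L : {linear 'cV[R]_(\dim {: V}) -> 'cV[R]_(\dim {: tens V W})} :=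
  HB.pack (@ext_tens V W ^~ y) (GRing.isLinear.Build R _ _ _ _ lx).
by rewrite -[LHS]/(L _) linear_sum; apply: eq_bigr => i _; rewrite linearZ.
Qed.

Lemma ext_tens_sumr V W n (k : 'I_n -> R) (e : 'I_n -> 'cV[R]_(\dim {: W}))
    (x : 'cV[R]_(\dim {: V})) :
  ext_tens x (\sum_i k i *: e i) = \sum_i k i *: ext_tens x (e i).
Proof.
have ly : linear (@ext_tens V W x).
  move=> c u v; rewrite /ext_tens scaler_sumr -big_split.
  apply: eq_bigr => i _; rewrite scaler_sumr -big_split.
  by apply: eq_bigr => j _ /=; rewrite !mxE scalerA -scalerDl mulrDr mulrCA.
pose L : {linear 'cV[R]_(\dim {: W}) -> 'cV[R]_(\dim {: tens V W})} :=
  HB.pack (@ext_tens V W x) (GRing.isLinear.Build R _ _ _ _ ly).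
by rewrite -[LHS]/(L _) linear_sum; apply: eq_bigr => i _; rewrite linearZ.
Qed.

Lemma col_sum_delta n (u : 'cV[R]_n) : u = \sum_i u i 0 *: delta_mx i 0.
Proof.
by rewrite [LHS]matrix_sum_delta; apply: eq_bigr => i _; rewrite big_ord1.
Qed.

End Extension.
End FiniteDimensional.

Section Rep.
Variables (F : fieldType) (G : topGroupType).

Record rep := Rep {
  rep_space :> vectType F;
  rep_act : G -> 'End(rep_space);
  rep_act1 : rep_act 1%g = \1%VF;
  rep_actM : forall g h, rep_act (g * h)%g = (rep_act g \o rep_act h)%VF;
  rep_continuous : continuous
    (fun p : G * discrete_topology rep_space =>
       rep_act p.1 p.2 : discrete_topology rep_space)
}.
Arguments rep_act : clear implicits.

Definition rep_hom (V W : rep) (f : 'Hom(V, W)) : Prop :=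
  forall g, (f \o rep_act V g = rep_act W g \o f)%VF.

Lemma rep_near (V : rep) g : \forall h \near g, rep_act V h = rep_act V g.
Proof.
have : \forall h \near g, forall i : 'I_(\dim {: V}),
    rep_act V h (vbasis {: V})`_i = rep_act V g (vbasis {: V})`_i.
  apply: filter_forall => i; set v := _`_i.
  have /(_ (g, v)) cv := @rep_continuous V.
  have [[A B] /= [gA vB] AB] := cv _
    (discrete_set1 (X := discrete_topology V) (rep_act V g v)).
  apply: filterS gA => h Ah; apply: (AB (h, v)); split => //=.
  exact: nbhs_singleton vB.
apply: filterS => h e; apply/lfunP => v; rewrite (coord_vbasis (memvf v)).
by rewrite !linear_sum; apply: eq_bigr => i _; rewrite !linearZ /= e.
Qed.

Lemma near_rep_continuous (V : vectType F) (a : G -> 'End(V)) :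
  (forall g, \forall h \near g, a h = a g) ->
  continuous (fun p : G * discrete_topology V =>
    a p.1 p.2 : discrete_topology V).
Proof.
move=> aP [g v]; apply/discrete_cvg.
exists ([set h | a h = a g], [set v])%classic => /=.
  by split; [exact: aP|exact: (discrete_set1 (X := discrete_topology V))].
by move=> [h w] /= [-> ->].
Qed.

Lemma trivial_near (g : G) : \forall h \near g, \1%VF = \1%VF :> 'End(F^o).
Proof. exact: nearW. Qed.
Lemma trivial_actM (g h : G) : \1%VF = (\1%VF \o \1%VF)%VF :> 'End(F^o).
Proof. by rewrite comp_lfun1l. Qed.
Definition rep_unit : rep :=
  @Rep F^o (fun=> \1%VF) erefl trivial_actM (near_rep_continuous trivial_near).

Section Tensor.
Variables V W : rep.
Definition tens_act (g : G) : 'End(tens V W) :=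
  tens_map (rep_act V g) (rep_act W g).
Lemma tens_act1 : tens_act 1%g = \1%VF.
Proof.
apply/lfunP => M; rewrite tens_mapE !rep_act1 !lmx1 trmx1 mul1mx mulmx1.
by rewrite id_lfunE.
Qed.
Lemma tens_actM g h : tens_act (g * h)%g = (tens_act g \o tens_act h)%VF.
Proof.
apply/lfunP => M; rewrite comp_lfunE !tens_mapE !rep_actM !lmxM trmx_mul.
by rewrite !mulmxA.
Qed.
Lemma tens_near g : \forall h \near g, tens_act h = tens_act g.
Proof.
apply: filterS2 (rep_near V g) (rep_near W g) => h e f.
by rewrite /tens_act e f.
Qed.
Definition rep_tens : rep :=
  Rep tens_act1 tens_actM (near_rep_continuous tens_near).
End Tensor.

(* The R-points of Aut^(x)(omega): the R-linear automorphisms of V_R, for V   *)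
(* ranging over all representations, that are natural in V and compatible     *)
(* with tensor products and the unit object.                                  *)
Record tens_aut (R : comAlgType F) := TensAut {
  ta_mx :> forall V : rep, 'M[R]_(\dim {: V});
  ta_unitmx : forall V, exists2 B, B *m ta_mx V = 1%:M & ta_mx V *m B = 1%:M;
  ta_natural : forall (V W : rep) (f : 'Hom(V, W)), rep_hom f ->
    ta_mx W *m ext_map R f = ext_map R f *m ta_mx V;
  ta_unit : ta_mx rep_unit = 1%:M;
  ta_tens : forall (V W : rep) x y,
    ta_mx (rep_tens V W) *m ext_tens x y =
      ext_tens (ta_mx V *m x) (ta_mx W *m y)
}.

Lemma tens_aut_ext R (a b : tens_aut R) : (forall V, a V = b V) -> a = b.
Proof.
case: a b => [a a1 a2 a3 a4] [b b1 b2 b3 b4] /= e.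
have eab : a = b by exact: functional_extensionality_dep.
by case: _ / eab b1 b2 b3 b4 => *; congr TensAut; exact: Prop_irrelevance.
Qed.

Section Group.
Variable R : comAlgType F.
Implicit Types a b c : tens_aut R.

Lemma ta_one_unitmx (V : rep) : exists2 B : 'M[R]_(\dim {: V}),
  B *m 1%:M = 1%:M & 1%:M *m B = 1%:M.
Proof. by exists 1%:M; rewrite mulmx1. Qed.
Lemma ta_one_natural (V W : rep) (f : 'Hom(V, W)) : rep_hom f ->
  1%:M *m ext_map R f = ext_map R f *m 1%:M.
Proof. by rewrite mul1mx mulmx1. Qed.
Lemma ta_one_tens (V W : rep) (x : 'cV[R]_(\dim {: V}))
    (y : 'cV[R]_(\dim {: W})) :
  1%:M *m ext_tens x y = ext_tens (1%:M *m x) (1%:M *m y).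
Proof. by rewrite !mul1mx. Qed.
Definition ta_one : tens_aut R :=
  TensAut ta_one_unitmx ta_one_natural erefl ta_one_tens.

Lemma ta_mul_unitmx a b V :
  exists2 B, B *m (a V *m b V) = 1%:M & a V *m b V *m B = 1%:M.
Proof.
have [A Aa aA] := ta_unitmx a V; have [B Bb bB] := ta_unitmx b V.
exists (B *m A); first by rewrite mulmxA -(mulmxA B) Aa mulmx1.
by rewrite mulmxA -(mulmxA (a V)) bB mulmx1.
Qed.
Lemma ta_mul_natural a b (V W : rep) (f : 'Hom(V, W)) : rep_hom f ->
  a W *m b W *m ext_map R f = ext_map R f *m (a V *m b V).
Proof.
by move=> fP; rewrite -mulmxA !ta_natural // !mulmxA ta_natural.
Qed.
Lemma ta_mul_unit a b : a rep_unit *m b rep_unit = 1%:M.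
Proof. by rewrite !ta_unit mulmx1. Qed.
Lemma ta_mul_tens a b (V W : rep) x y :
  a (rep_tens V W) *m b (rep_tens V W) *m ext_tens x y =
    ext_tens (a V *m b V *m x) (a W *m b W *m y).
Proof. by rewrite -mulmxA !ta_tens !mulmxA. Qed.
Definition ta_mul a b : tens_aut R :=
  TensAut (ta_mul_unitmx a b) (@ta_mul_natural a b) (ta_mul_unit a b)
    (@ta_mul_tens a b).

Definition ta_inv_mx a (V : rep) : 'M[R]_(\dim {: V}) :=
  s2val (cid2 (ta_unitmx a V)).
Lemma ta_mulVmx a V : ta_inv_mx a V *m a V = 1%:M.
Proof. by rewrite /ta_inv_mx; case: cid2. Qed.
Lemma ta_mulmxV a V : a V *m ta_inv_mx a V = 1%:M.
Proof. by rewrite /ta_inv_mx; case: cid2. Qed.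
Lemma ta_inv_unitmx a V :
  exists2 B, B *m ta_inv_mx a V = 1%:M & ta_inv_mx a V *m B = 1%:M.
Proof. by exists (a V); rewrite ?ta_mulVmx ?ta_mulmxV. Qed.
Lemma ta_inv_natural a (V W : rep) (f : 'Hom(V, W)) : rep_hom f ->
  ta_inv_mx a W *m ext_map R f = ext_map R f *m ta_inv_mx a V.
Proof.
move=> fP; rewrite -[LHS]mulmx1 -(ta_mulmxV a V) !mulmxA.
by rewrite -(mulmxA _ (ext_map R f)) -ta_natural // !mulmxA ta_mulVmx mul1mx.
Qed.
Lemma ta_inv_unit a : ta_inv_mx a rep_unit = 1%:M.
Proof. by move: (ta_mulVmx a rep_unit); rewrite ta_unit mulmx1. Qed.
Lemma ta_inv_tens a (V W : rep) x y :
  ta_inv_mx a (rep_tens V W) *m ext_tens x y =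
    ext_tens (ta_inv_mx a V *m x) (ta_inv_mx a W *m y).
Proof.
rewrite -{1}[x]mul1mx -{1}[y]mul1mx -(ta_mulmxV a V) -(ta_mulmxV a W).
by rewrite -!mulmxA -ta_tens mulmxA ta_mulVmx mul1mx.
Qed.
Definition ta_inv a : tens_aut R :=
  TensAut (ta_inv_unitmx a) (@ta_inv_natural a) (ta_inv_unit a)
    (@ta_inv_tens a).

Lemma ta_mulA : associative ta_mul.
Proof. by move=> a b c; apply: tens_aut_ext => V; exact: mulmxA. Qed.
Lemma ta_mul1g : left_id ta_one ta_mul.
Proof. by move=> a; apply: tens_aut_ext => V; exact: mul1mx. Qed.
Lemma ta_mulVg : left_inverse ta_one ta_inv ta_mul.
Proof. by move=> a; apply: tens_aut_ext => V; exact: ta_mulVmx. Qed.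
End Group.

Section Functor.
Variables (R S : comAlgType F) (f : {lrmorphism R -> S}).

Lemma map_ext_vec (V : vectType F) (v : V) :
  map_mx f (ext_vec R v) = ext_vec S v.
Proof. by apply/matrixP => i j; rewrite !mxE linearZ /= rmorph1. Qed.
Lemma map_ext_map (V W : vectType F) (h : 'Hom(V, W)) :
  map_mx f (ext_map R h) = ext_map S h.
Proof. by apply/matrixP => i j; rewrite !mxE linearZ /= rmorph1. Qed.

Lemma ta_map_unitmx (a : tens_aut R) V :
  exists2 B, B *m map_mx f (a V) = 1%:M & map_mx f (a V) *m B = 1%:M.
Proof.
have [B Ba aB] := ta_unitmx a V; exists (map_mx f B).
  by rewrite -map_mxM Ba map_mx1.
by rewrite -map_mxM aB map_mx1.
Qed.
Lemma ta_map_natural (a : tens_aut R) (V W : rep) (h : 'Hom(V, W)) :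
  rep_hom h ->
  map_mx f (a W) *m ext_map S h = ext_map S h *m map_mx f (a V).
Proof. by move=> hP; rewrite -!map_ext_map -!map_mxM ta_natural. Qed.
Lemma ta_map_unit (a : tens_aut R) : map_mx f (a rep_unit) = 1%:M.
Proof. by rewrite ta_unit map_mx1. Qed.

Lemma map_ext_tens (V W : vectType F) (x : 'cV[R]_(\dim {: V}))
    (y : 'cV[R]_(\dim {: W})) :
  map_mx f (ext_tens x y) = ext_tens (map_mx f x) (map_mx f y).
Proof.
rewrite /ext_tens map_mx_sum; apply: eq_bigr => i _.
rewrite map_mx_sum; apply: eq_bigr => j _.
by rewrite map_mxZ map_ext_vec rmorphM !mxE.
Qed.

Lemma ta_map_tens (a : tens_aut R) (V W : rep) x y :
  map_mx f (a (rep_tens V W)) *m ext_tens x y =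
    ext_tens (map_mx f (a V) *m x) (map_mx f (a W) *m y).
Proof.
rewrite (col_sum_delta x) (col_sum_delta y) ext_tens_suml !mulmx_sumr.
under [in RHS]eq_bigr => i _ do rewrite -scalemxAr.
rewrite ext_tens_suml; apply: eq_bigr => i _.
rewrite -scalemxAr; congr (_ *: _).
rewrite ext_tens_sumr !mulmx_sumr.
under [in RHS]eq_bigr => j _ do rewrite -scalemxAr.
rewrite ext_tens_sumr; apply: eq_bigr => j _.
rewrite -scalemxAr; congr (_ *: _).
have dS n (k : 'I_n) : delta_mx k 0 = map_mx f (delta_mx k 0) :> 'cV_n.
  by rewrite map_delta_mx.
by rewrite !dS -!map_mxM -!map_ext_tens -map_mxM ta_tens.
Qed.

Definition ta_map (a : tens_aut R) : tens_aut S :=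
  TensAut (ta_map_unitmx a) (@ta_map_natural a) (ta_map_unit a)
    (@ta_map_tens a).
Lemma ta_mapM : {morph ta_map : a b / ta_mul a b}.
Proof. by move=> a b; apply: tens_aut_ext => V; exact: map_mxM. Qed.
End Functor.

Lemma ta_map_id (R : comAlgType F) (f : {lrmorphism R -> R}) :
  f =1 id -> ta_map f =1 id.
Proof.
by move=> f1 a; apply: tens_aut_ext => V; apply/matrixP => i j; rewrite mxE f1.
Qed.
Lemma ta_map_comp (R S T : comAlgType F) (f : {lrmorphism R -> S})
    (g : {lrmorphism S -> T}) (h : {lrmorphism R -> T}) :
  h =1 g \o f -> ta_map h =1 ta_map g \o ta_map f.
Proof.
by move=> hE a; apply: tens_aut_ext => V; apply/matrixP => i j; rewrite !mxE hE.
Qed.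

(* The Tannakian dual Aut^(x)(omega) of the category of continuous            *)
(* representations of G with its forgetful functor omega.                     *)
Definition alg_hull : grp_functor F :=
  GrpFunctor ta_mulA ta_mul1g ta_mulVg ta_mapM ta_map_id ta_map_comp.

End Rep.

(* Main.v *)
Require Import Defs.
From HB Require Import structures.
From mathcomp Require Import all_boot all_order all_fingroup all_algebra.
From mathcomp Require Import boolp classical_sets cardinality topology.

(** Reconstruct a point of the inverse limit from a tensor automorphism [a] by
    letting [a] act on the regular representations [V_i = F^(P_i)] and
    evaluating at [1]: multiplication and the unit of [F^(P_i)] are morphisms of
    representations, so [f |-> (a f)(1)] is an algebra morphism [F^(P_i) -> R].
    Conversely a point [x_i : F^(P_i) -> R] acts on a representation [V] that
    factors through [P_i] by [sum_h x_i(delta_h) rho(h)]; the [x_i(delta_h)] are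
    orthogonal idempotents of sum [1], and on each of them the action is that of
    a single group element, which makes it a tensor automorphism. The two
    constructions are mutually inverse because matrix coefficients
    [v |-> (h |-> l(h v))] are morphisms [V -> V_i]. Every [V] factors through
    some [P_i] by continuity, and [pi -> P_i] is onto by compactness. *)

Set Implicit Arguments.
Unset Strict Implicit.
Unset Printing Implicit Defensive.

Import Order.TTheory GRing.Theory.

(** * Compactness and neighbourhoods in a profinite group *)

Section ProfiniteGroup.
Variables (d : Order.disp_t) (I : preorderType d) (P : I -> finGroupType).
Variable t : inv_system (fun i => P i).
Hypothesis I_inhabited : inhabited I.
Hypothesis I_directed : forall i j : I, exists k : I, (i <= k)%O /\ (j <= k)%O.

Lemma profinite_surj :
  (forall (i j : I) (le_ij : (i <= j)%O) (y : P i),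
     exists x : P j, inv_tr t le_ij x = y) ->
  forall i (y : P i), exists x : profinite t, lim_val x i = y.
Proof.
move=> t_surj i0 y0.
(* Levels not above [i0] carry no condition, so the value 1 there is a mere default. *)
have lift_ex j : exists z : P j,
    forall le_ij : (i0 <= j)%O, inv_tr t le_ij z = y0.
  have [ij|nij] := pselect (i0 <= j)%O; last first.
    by exists 1%g => ij; case: (nij ij).
  have [z zP] := t_surj _ _ ij y0; exists z => ij'.
  by rewrite (bool_irrelevance ij' ij).
pose l j := projT1 (cid (lift_ex j)).
have lP j (le_ij : (i0 <= j)%O) : inv_tr t le_ij (l j) = y0.
  by rewrite /l; case: cid.
(* The net [y] of partial lifts of [y0]: its term [y k] is compatible below   *)
(* [k], so a cluster point in the compact product is compatible everywhere.   *)
pose X := prod_topology (fun i => discrete_topology (P i)).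
pose y k : X := fun j =>
  if pselect (j <= k)%O is left jk then inv_tr t jk (l k) else 1%g.
have yE k j (jk : (j <= k)%O) : y k j = inv_tr t jk (l k).
  rewrite /y; case: pselect => [jk'|/(_ jk)//].
  by rewrite (bool_irrelevance jk' jk).
pose B (j : I) := [set k : I | (j <= k)%O]%classic.
(* The filter of final segments of [I]; directedness gives closure under intersection. *)
pose Fi : set_system I := [set A | exists j, B j `<=` A]%classic.
have FF : ProperFilter Fi.
  split; first by move=> [j /(_ j)]; apply; exact: lexx.
  case: I_inhabited => j0; split.
  - by exists j0.
  - move=> A A' [j jA] [j' jA']; have [k [jk jk']] := I_directed j j'.
    by exists k => z kz; split; [apply: jA|apply: jA']; apply: le_trans kz.
  - by move=> A A' AA' [j jA]; exists j => z /jA /AA'.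
have cpt := @tychonoff I (fun i => discrete_topology (P i)) (fun=> setT)
  (fun i => @finite_compact (discrete_topology (P i)) setT
    (@finite_finset (P i) setT)).
have [|x [_ xc]] := cpt (y @ Fi)%classic _.
  by case: I_inhabited => j0; exists j0.
have fx : Filter (nbhs (x : X)) by exact: nbhs_filter.
have near_x i : nbhs (x : X) [set z | z i = x i]%classic.
  exact: (@proj_continuous I (fun i => discrete_topology (P i)) i x _
    (discrete_set1 _)).
(* Clustering gives arbitrarily high [k] where [y k] agrees with [x] at two coordinates at once;
   each compatibility condition involves only two. *)
have xP i j m : exists k, [/\ (m <= k)%O, y k i = x i & y k j = x j].
  have [|z [[k [mk ->]] [zi zj]]] := xc
    [set z | B m `&` [set k | z = y k] !=set0]%classic
    [set z | z i = x i /\ z j = x j]%classic _ (filterI (near_x i) (near_x j)).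
    by exists m => k mk; exists k.
  by exists k; split.
have x_tr i j (le_ij : (i <= j)%O) : inv_tr t le_ij (x j) = x i.
  have [k [jk <- <-]] := xP i j j.
  by rewrite (yE _ _ jk) (yE _ _ (le_trans le_ij jk)) (inv_tr_comp t le_ij jk).
exists (InvLim x_tr) => /=.
have [k [ik <- _]] := xP i0 i0 i0.
by rewrite (yE _ _ ik) lP.
Qed.

(** Directedness makes the fibres of the projections through [g] a filter base. Its image converges
    to [g] in each discrete factor, hence in the product, and the topology of the limit is the
    initial one. *)
Lemma profinite_nbhs_base (g : profinite t) (A : set (profinite t)) :
  nbhs g A -> exists i, forall h, lim_val h i = lim_val g i -> A h.
Proof.
pose Fi : set_system (profinite t) :=
  [set B | exists i, forall h, lim_val h i = lim_val g i -> B h]%classic.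
have FF : Filter Fi.
  case: I_inhabited => j0; split.
  - by exists j0.
  - move=> B B' [j jB] [j' jB']; have [k [jk jk']] := I_directed j j'.
    exists k => h hk; split; [apply: jB|apply: jB'].
      by rewrite -(lim_tr h jk) -(lim_tr g jk) hk.
    by rewrite -(lim_tr h jk') -(lim_tr g jk') hk.
  - by move=> B B' BB' [j jB]; exists j => z /jB /BB'.
pose X := prod_topology (fun i => discrete_topology (P i)).
have cv : ((@profinite_val _ _ _ t) @ Fi --> (profinite_val g : X))%classic.
  apply/cvg_sup => i U [V [[W _ <-] Wx VU]].
  by exists i => h e; apply: VU; rewrite /= /profinite_val e.
case=> V [[W oW <-] Wg] /= VA.
by have [i iW] := cv _ (open_nbhs_nbhs (conj oW Wg)); exists i => h /iW /VA.
Qed.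
End ProfiniteGroup.

(** * Scalar extension of linear maps, tensors and linear forms *)

Section LinearMaps.
Local Open Scope ring_scope.
Variable F : fieldType.
Implicit Types V W U : vectType F.

Definition mk_hom V W (f : V -> W) (f_lin : linear f) : 'Hom(V, W) :=
  linfun (HB.pack f (GRing.isLinear.Build F V W _ _ f_lin) : {linear V -> W}).

Lemma mk_homE V W (f : V -> W) (f_lin : linear f) v : mk_hom f_lin v = f v.
Proof. by rewrite /mk_hom lfunE. Qed.

Lemma ptens_sum V W (v : V) (w : W) :
  ptens v w = \sum_i coord (vbasis {: V}) i v *:
    \sum_j coord (vbasis {: W}) j w *:
      ptens (vbasis {: V})`_i (vbasis {: W})`_j.
Proof.
rewrite [LHS]matrix_sum_delta; apply: eq_bigr => i _; rewrite scaler_sumr.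
by apply: eq_bigr => j _; rewrite ptens_basis mxE scalerA.
Qed.

Lemma tens_hom_ext V W U (f g : 'Hom(tens V W, U)) :
  (forall v w, f (ptens v w) = g (ptens v w)) -> f = g.
Proof.
move=> fg; apply/lfunP => M; rewrite [M]matrix_sum_delta !linear_sum.
apply: eq_bigr => i _; rewrite !linear_sum; apply: eq_bigr => j _.
by rewrite !linearZ /= -ptens_basis fg.
Qed.

Variable R : comAlgType F.

Lemma ext_vec_sum V n (c : 'I_n -> F) (v : 'I_n -> V) :
  ext_vec R (\sum_i c i *: v i) = \sum_i (c i)%:A *: ext_vec R (v i).
Proof.
apply/colP => k; rewrite !mxE linear_sum scaler_suml summxE.
by apply: eq_bigr => i _; rewrite !mxE linearZ /= -scalerA -scalerAl mul1r.
Qed.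

Lemma ext_vecP V c (v w : V) :
  ext_vec R (c *: v + w) = c%:A *: ext_vec R v + ext_vec R w.
Proof.
apply/colP => k; rewrite !mxE linearP scalerDl.
by rewrite -scalerAl mul1r scalerA.
Qed.

Lemma ext_vec_basis V (j : 'I_(\dim {: V})) :
  ext_vec R (vbasis {: V})`_j = delta_mx j 0.
Proof.
apply/colP => k; rewrite !mxE coord_basis_delta eqxx andbT.
by case: (k == j); rewrite ?scale1r ?scale0r.
Qed.

Lemma ext_map_vec V W (f : 'Hom(V, W)) v :
  ext_map R f *m ext_vec R v = ext_vec R (f v).
Proof.
apply/colP => i; rewrite !mxE lmx_coord scaler_suml.
by apply: eq_bigr => j _; rewrite !mxE -scalerAl mul1r scalerA.
Qed.

Lemma ext_tens_vec V W (v : V) (w : W) :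
  ext_tens (ext_vec R v) (ext_vec R w) = ext_vec R (ptens v w).
Proof.
rewrite ptens_sum ext_vec_sum; apply: eq_bigr => i _.
rewrite ext_vec_sum scaler_sumr; apply: eq_bigr => j _.
by rewrite !mxE scalerA.
Qed.

Lemma ext_map_sum V W (f : 'Hom(V, W)) (x : 'cV[R]_(\dim {: V})) :
  ext_map R f *m x = \sum_i x i 0 *: ext_vec R (f (vbasis {: V})`_i).
Proof.
rewrite [in LHS](col_sum_delta x) linear_sum; apply: eq_bigr => i _.
by rewrite linearZ /= -ext_vec_basis ext_map_vec.
Qed.

Lemma ext_map_tens V V' W W' (f : 'Hom(V, V')) (g : 'Hom(W, W'))
    (x : 'cV[R]_(\dim {: V})) (y : 'cV[R]_(\dim {: W})) :
  ext_map R (tens_map f g) *m ext_tens x y =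
    ext_tens (ext_map R f *m x) (ext_map R g *m y).
Proof.
rewrite (ext_map_sum f) (ext_map_sum g) ext_tens_suml {1}/ext_tens linear_sum.
apply: eq_bigr => i _; rewrite ext_tens_sumr scaler_sumr linear_sum.
apply: eq_bigr => j _.
by rewrite linearZ /= ext_map_vec tens_map_ptens ext_tens_vec scalerA.
Qed.

Lemma ext_tensZl V W (c : R) (x : 'cV[R]_(\dim {: V}))
    (y : 'cV[R]_(\dim {: W})) : ext_tens (c *: x) y = c *: ext_tens x y.
Proof.
rewrite /ext_tens scaler_sumr; apply: eq_bigr => i _; rewrite scaler_sumr.
by apply: eq_bigr => j _; rewrite mxE -mulrA scalerA.
Qed.

Lemma ext_tensZr V W (c : R) (x : 'cV[R]_(\dim {: V}))
    (y : 'cV[R]_(\dim {: W})) : ext_tens x (c *: y) = c *: ext_tens x y.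
Proof.
rewrite /ext_tens scaler_sumr; apply: eq_bigr => i _; rewrite scaler_sumr.
by apply: eq_bigr => j _; rewrite mxE mulrCA scalerA.
Qed.

(* The scalar extension [l (x) 1 : V_R -> R] of a linear form. *)
Definition ext_form V (l : 'Hom(V, F^o)) (y : 'cV[R]_(\dim {: V})) : R :=
  \sum_(j < \dim {: V}) (l (vbasis {: V})`_j)%:A * y j 0.

Lemma ext_form_linear V (l : 'Hom(V, F^o)) : linear (ext_form l : _ -> R^o).
Proof.
move=> c x y; rewrite /ext_form scaler_sumr -big_split.
by apply: eq_bigr => j _; rewrite !mxE mulrDr; congr (_ + _); rewrite mulrCA.
Qed.

HB.instance Definition _ V (l : 'Hom(V, F^o)) :=
  GRing.isLinear.Build R 'cV[R]_(\dim {: V}) R^o _ (ext_form l)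
    (@ext_form_linear V l).

Lemma ext_form_vec V (l : 'Hom(V, F^o)) v : ext_form l (ext_vec R v) = (l v)%:A.
Proof.
rewrite [in RHS](coord_vbasis (memvf v)) linear_sum scaler_suml.
by apply: eq_bigr => j _; rewrite linearZ mxE -scalerAr mulr1 scalerA.
Qed.

Lemma ext_form_map V W (f : 'Hom(V, W)) (l : 'Hom(W, F^o)) y :
  ext_form l (ext_map R f *m y) = ext_form (l \o f)%VF y.
Proof.
rewrite (col_sum_delta y) mulmx_sumr !linear_sum; apply: eq_bigr => i _.
rewrite -scalemxAr !linearZ /= -ext_vec_basis ext_map_vec !ext_form_vec.
by rewrite comp_lfunE.
Qed.

(** With [b] the product of functions followed by evaluation at 1, this turns compatibility with
    tensor products into multiplicativity. *)
Lemma ext_form_tens V W (l : 'Hom(V, F^o)) (m : 'Hom(W, F^o))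
    (b : 'Hom(tens V W, F^o)) x y :
  (forall v w, b (ptens v w) = l v * m w) ->
  ext_form b (ext_tens x y) = ext_form l x * ext_form m y.
Proof.
move=> bE; rewrite linear_sum mulr_suml; apply: eq_bigr => i _.
rewrite linear_sum mulr_sumr; apply: eq_bigr => j _.
rewrite linearZ /= ext_form_vec bE mulrACA [RHS]mulrC; congr (_ * _).
by rewrite -scalerAl mul1r scalerA.
Qed.

Lemma coord_linear V k : linear (coord (vbasis {: V}) k : V -> F^o).
Proof. by move=> c u v; rewrite linearP. Qed.

Definition coordf V (k : 'I_(\dim {: V})) : 'Hom(V, F^o) :=
  mk_hom (@coord_linear V k).

Lemma coordfE V k v : @coordf V k v = coord (vbasis {: V}) k v.
Proof. exact: mk_homE. Qed.

Lemma ext_form_coordf V k y : ext_form (@coordf V k) y = y k 0.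
Proof.
rewrite /ext_form (bigD1 k) //= coordfE coord_basis_delta eqxx scale1r mul1r.
rewrite big1 ?addr0 // => j /negbTE jk.
by rewrite coordfE coord_basis_delta eq_sym jk scale0r mul0r.
Qed.

Lemma ext_map1 V : ext_map R \1%VF = 1%:M :> 'M_(\dim {: V}).
Proof. by rewrite /ext_map lmx1 map_mx1. Qed.

Lemma ext_mapM V W U (f : 'Hom(W, U)) (g : 'Hom(V, W)) :
  ext_map R (f \o g)%VF = ext_map R f *m ext_map R g.
Proof. by rewrite /ext_map lmxM map_mxM. Qed.
End LinearMaps.

Lemma map_ext_form (F : fieldType) (R S : comAlgType F)
    (f : {lrmorphism R -> S}) (V : vectType F) (l : 'Hom(V, F^o)) (y : 'cV[R]_(\dim {: V})) :
  ext_form l (map_mx f y) = f (ext_form l y).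
Proof.
rewrite /ext_form rmorph_sum; apply: eq_bigr => j _.
by rewrite rmorphM /= linearZ /= rmorph1 mxE.
Qed.

(** * Points of a constant group scheme and the algebra of functions *)

Section ConstantPoints.
Local Open Scope ring_scope.
Variables (F : fieldType) (Gamma : finGroupType) (R : comAlgType F).
Implicit Type x : const_ob Gamma R.

(** Since [ffdelta F h * f] is [f h *: ffdelta F h], a point becomes evaluation at [h] on the
    summand of [R] cut out by the idempotent [x (ffdelta F h)]. *)
Lemma co_delta_mul x h (f : {ffun Gamma -> F^o}) :
  x (ffdelta F h) * x f = f h *: x (ffdelta F h).
Proof.
rewrite (coE x f) mulr_sumr (bigD1 h) //= -scalerAr co_deltaM eqxx scale1r.
rewrite big1 ?addr0 // => g /negbTE gh.
by rewrite -scalerAr co_deltaM eq_sym gh scale0r scaler0.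
Qed.

(* The [x (ffdelta F h)] are orthogonal idempotents of sum [1].               *)
Lemma co_local x m n (A B : 'M[R]_(m, n)) :
  (forall h, x (ffdelta F h) *: A = x (ffdelta F h) *: B) -> A = B.
Proof.
move=> AB; rewrite -[A]scale1r -[B]scale1r -(co_delta_sum x) !scaler_suml.
by apply: eq_bigr => h _; rewrite AB.
Qed.

Lemma co_localr x (a b : R) :
  (forall h, x (ffdelta F h) * a = x (ffdelta F h) * b) -> a = b.
Proof.
move=> ab; rewrite -[a]mul1r -[b]mul1r -(co_delta_sum x) !mulr_suml.
by apply: eq_bigr => h _; rewrite ab.
Qed.

Lemma ffpull_linear (A B : finGroupType) (p : A -> B) :
  linear (ffpull p : {ffun B -> F^o} -> {ffun A -> F^o}).
Proof. by move=> c f g; apply/ffunP => h; rewrite !ffunE. Qed.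

Definition pull_hom (A B : finGroupType) (p : A -> B) :
  'Hom({ffun B -> F^o}, {ffun A -> F^o}) := mk_hom (ffpull_linear p).

Lemma pull_homE (A B : finGroupType) (p : A -> B) f h :
  pull_hom p f h = f (p h).
Proof. by rewrite mk_homE ffunE. Qed.

Lemma ev1_linear : linear (fun f : {ffun Gamma -> F^o} => f 1%g : F^o).
Proof. by move=> c f g; rewrite !ffunE. Qed.

Definition ev1 : 'Hom({ffun Gamma -> F^o}, F^o) := mk_hom ev1_linear.

Lemma ev1E f : ev1 f = f 1%g.
Proof. exact: mk_homE. Qed.

Lemma ffmul_hom : exists m : 'Hom(tens {ffun Gamma -> F^o} {ffun Gamma -> F^o},
    {ffun Gamma -> F^o}), forall f g, m (ptens f g) = f * g.
Proof.
have [||m [mE _]] := @tens_univ F {ffun Gamma -> F^o} {ffun Gamma -> F^o}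
  {ffun Gamma -> F^o} (fun f g => f * g); last by exists m.
  by move=> g c f f'; apply/ffunP => h; rewrite !ffunE mulrDl scalerAl.
by move=> g c f f'; apply/ffunP => h; rewrite !ffunE mulrDr scalerAr.
Qed.

Lemma scalar_hom : exists u : 'Hom(F^o, {ffun Gamma -> F^o}),
  forall c, u c = [ffun=> c].
Proof.
have ul : linear (fun c : F^o => [ffun=> c] : {ffun Gamma -> F^o}).
  by move=> c x y; apply/ffunP => h; rewrite !ffunE.
by exists (mk_hom ul) => c; rewrite mk_homE.
Qed.
End ConstantPoints.

Section TannakianPoints.
Local Open Scope ring_scope.
Variables (F : fieldType) (d : Order.disp_t) (I : preorderType d).
Variables (P : I -> finGroupType) (t : inv_system (fun i => P i)).
Local Notation G := (profinite t).

(** * Regular representations of the finite levels *)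

Section RegularRep.
Variable i : I.
(** Right translation is a left action on functions, and the one for which [v |-> (h |-> l (h v))]
    is equivariant. *)
Definition reg_act (g : G) : 'End({ffun P i -> F^o}) :=
  pull_hom F (fun h => (h * lim_val g i)%g).

Lemma reg_actE g f h : reg_act g f h = f (h * lim_val g i)%g.
Proof. exact: pull_homE. Qed.

Lemma reg_act1 : reg_act 1%g = \1%VF.
Proof.
by apply/lfunP => f; apply/ffunP => h; rewrite reg_actE id_lfunE /= mulg1.
Qed.

Lemma reg_actM g h : reg_act (g * h)%g = (reg_act g \o reg_act h)%VF.
Proof.
apply/lfunP => f; apply/ffunP => k.
by rewrite comp_lfunE !reg_actE /= mulgA.
Qed.

Lemma reg_near (g : G) : \forall h \near g, reg_act h = reg_act g.
Proof.
apply: filterS (profinite_near g i) => h e; apply/lfunP => f.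
by apply/ffunP => k; rewrite !reg_actE; congr (f (_ * _)%g).
Qed.

Definition reg_rep : rep F G :=
  Rep reg_act1 reg_actM (near_rep_continuous reg_near).
End RegularRep.

Variable R : comAlgType F.

(** * From a tensor automorphism to a point of the limit *)

Section PointOfAutomorphism.
Variable a : tens_aut G R.

Definition ta_form i (f : {ffun P i -> F^o}) : R :=
  ext_form (ev1 F (P i)) (a (reg_rep i) *m @ext_vec F R (reg_rep i) f).

Lemma ta_form_linear i : linear (@ta_form i).
Proof.
move=> c f g; rewrite /ta_form ext_vecP mulmxDr -scalemxAr linearP /=.
by congr (_ + _); exact: mulr_algl.
Qed.

(** The constant functions are the image of a morphism from the unit representation, on which [a] is
    the identity. *)
Lemma ta_form1 i : ta_form (1 : {ffun P i -> F^o}) = 1.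
Proof.
have [u uE] := scalar_hom F (P i).
have uP : @rep_hom F G (rep_unit F G) (reg_rep i) u.
  move=> g; apply/lfunP => c; rewrite !comp_lfunE id_lfunE; apply/ffunP => h.
  by rewrite reg_actE uE !ffunE.
have -> : ta_form (1 : {ffun P i -> F^o}) =
    ext_form (ev1 F (P i))
      (a (reg_rep i) *m (ext_map R u *m ext_vec R (1 : F^o))).
  rewrite ext_map_vec; suff -> : u 1 = 1 by [].
  by rewrite uE; apply/ffunP => h; rewrite !ffunE.
rewrite mulmxA (ta_natural a uP) ta_unit mulmx1 ext_map_vec ext_form_vec.
by rewrite ev1E uE ffunE scale1r.
Qed.

(** Pointwise multiplication is equivariant, so it intertwines [a] on the tensor square with [a] on
    functions; evaluation at 1 is multiplicative. *)
Lemma ta_formM i : {morph @ta_form i : f g / f * g}.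
Proof.
move=> f g; have [m mE] := ffmul_hom F (P i).
have mP : @rep_hom F G (rep_tens (reg_rep i) (reg_rep i)) (reg_rep i) m.
  move=> k; apply: tens_hom_ext => v w; apply/ffunP => h.
  rewrite !comp_lfunE tens_map_ptens !mE.
  by rewrite -[rep_act _]/(@reg_act i) !(reg_actE, ffunE).
rewrite /ta_form -[in LHS]mE -ext_map_vec -ext_tens_vec mulmxA.
rewrite (ta_natural a mP) -mulmxA ta_tens ext_form_map.
by apply: ext_form_tens => v w; rewrite comp_lfunE mE !ev1E ffunE.
Qed.

(** Pullback along the transition map is a morphism of regular representations and preserves the
    value at 1. *)
Lemma ta_form_tr i j (le_ij : (i <= j)%O) (f : {ffun P i -> F^o}) :
  ta_form (ffpull (inv_tr t le_ij) f) = ta_form f.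
Proof.
pose p := pull_hom F (inv_tr t le_ij).
have pP : @rep_hom F G (reg_rep i) (reg_rep j) p.
  move=> g; apply/lfunP => b; apply/ffunP => h; rewrite !comp_lfunE.
  rewrite -[rep_act (reg_rep j)]/(@reg_act j).
  rewrite -[rep_act (reg_rep i)]/(@reg_act i).
  by rewrite !(reg_actE, pull_homE) inv_trM lim_tr.
have -> : ffpull (inv_tr t le_ij) f = p f by rewrite /p mk_homE.
rewrite /ta_form -ext_map_vec mulmxA (ta_natural a pP) -mulmxA ext_form_map.
congr (ext_form _ _); apply/lfunP => b.
by rewrite comp_lfunE !ev1E pull_homE inv_tr1.
Qed.

Definition ta_const i : const_ob (P i) R :=
  ConstOb (@ta_form_linear i) (ta_form1 i) (@ta_formM i).

Lemma ta_const_tr i j (le_ij : (i <= j)%O) :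
  gf_tr (const_system F t) le_ij R (ta_const j) = ta_const i.
Proof. by apply: const_ob_ext => g; exact: ta_form_tr. Qed.

Definition ta_point : gf_lim (const_system F t) R := GfLimOb ta_const_tr.
End PointOfAutomorphism.

(* A section of each projection [pi -> P i], not assumed multiplicative. *)
Variable s : forall i, P i -> G.
Arguments s : clear implicits.
Hypothesis sK : forall i h, lim_val (s i h) i = h.
Implicit Types (x y : gf_lim (const_system F t) R) (V W : rep F G).

(** * Representations that factor through a finite level *)

Definition factors (V : rep F G) i :=
  forall g h : G, lim_val g i = lim_val h i -> rep_act V g = rep_act V h.

Lemma factors_le V i j : (i <= j)%O -> factors V i -> factors V j.
Proof. by move=> le_ij Vi g h e; apply: Vi; rewrite -!(lim_tr _ le_ij) e. Qed.

Lemma factors_tens V W i :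
  factors V i -> factors W i -> factors (rep_tens V W) i.
Proof.
by move=> Vi Wi g h e; rewrite /= /tens_act (Vi _ _ e) (Wi _ _ e).
Qed.

Lemma factors_reg i : factors (reg_rep i) i.
Proof.
move=> g h e; apply/lfunP => f; apply/ffunP => k.
by rewrite -[rep_act _]/(@reg_act i) !reg_actE e.
Qed.

(** Once [V] factors through [P i], these matrix coefficients are independent of the section [s]. *)
Definition coef (V : rep F G) i k l : {ffun P i -> F^o} :=
  [ffun h => lmx (rep_act V (s i h)) k l].

Arguments coef : clear implicits.

Lemma coef_tr V i j (le_ij : (i <= j)%O) k l : factors V i ->
  ffpull (inv_tr t le_ij) (coef V i k l) = coef V j k l.
Proof.
move=> Vi; apply/ffunP => h; rewrite !ffunE.
by rewrite (Vi (s i (inv_tr t le_ij h)) (s j h)) // sK -(lim_tr _ le_ij) sK.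
Qed.

(* The action [sum_h x_i(delta_h) rho(s h)] of [x] on [V], entry by entry. *)
Definition hull_at (x : gf_lim (const_system F t) R) (V : rep F G) i :
    'M[R]_(\dim {: V}) :=
  \matrix_(k, l) (x i : const_ob (P i) R) (coef V i k l).

Lemma hull_at_le x V i j : (i <= j)%O -> factors V i ->
  hull_at x V j = hull_at x V i.
Proof.
move=> le_ij Vi; apply/matrixP => k l; rewrite !mxE -(coef_tr le_ij) //.
by rewrite -(gf_lim_tr x le_ij).
Qed.

Lemma hull_at_local x V i h :
  (x i : const_ob (P i) R) (ffdelta F h) *: hull_at x V i =
  (x i : const_ob (P i) R) (ffdelta F h) *: ext_map R (rep_act V (s i h)).
Proof.
apply/matrixP => k l; rewrite !mxE co_delta_mul ffunE.
by rewrite -scalerAr mulr1 mxE.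
Qed.

Hypothesis I_directed : forall i j : I, exists k : I, (i <= k)%O /\ (j <= k)%O.
Hypothesis reps_factor : forall V : rep F G, exists i, factors V i.

Definition level V : I := projT1 (cid (reps_factor V)).
Lemma levelP V : factors V (level V).
Proof. by rewrite /level; case: cid. Qed.

Definition hull_mx x V := hull_at x V (level V).

(** Two levels are compared at a common upper bound, so the choice made in [level] is immaterial. *)
Lemma hull_mxE x V i : factors V i -> hull_mx x V = hull_at x V i.
Proof.
move=> Vi; have [k [ik lk]] := I_directed i (level V).
by rewrite -(hull_at_le x ik Vi) (hull_at_le x lk (@levelP V)).
Qed.

(** * From a point of the limit to a tensor automorphism *)

Section AutomorphismOfPoint.
Variable x : gf_lim (const_system F t) R.
Local Notation e i h := ((x i : const_ob (P i) R) (ffdelta F h)).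

(** On each idempotent the matrix is the action of one group element; through [co_local] the axioms
    of a tensor automorphism reduce to that case. *)
Lemma hull_mx_local V i h : factors V i ->
  e i h *: hull_mx x V = e i h *: ext_map R (rep_act V (s i h)).
Proof. by move=> /hull_mxE ->; exact: hull_at_local. Qed.

Lemma hull_mx_unitmx V :
  exists2 B, B *m hull_mx x V = 1%:M & hull_mx x V *m B = 1%:M.
Proof.
pose i := level V.
(* The candidate inverse inverts the group element on each idempotent. *)
pose B := \sum_h e i h *: ext_map R (rep_act V (s i h)^-1%g).
have eB h : e i h *: B = e i h *: ext_map R (rep_act V (s i h)^-1%g).
  rewrite scaler_sumr (bigD1 h) //= scalerA co_deltaM eqxx scale1r.
  rewrite big1 ?addr0 // => g /negbTE gh.
  by rewrite scalerA co_deltaM eq_sym gh scale0r scale0r.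
exists B; apply: (@co_local _ _ _ (x i)) => h.
  rewrite scalemxAl eB -scalemxAl scalemxAr hull_mx_local; last exact: levelP.
  by rewrite -scalemxAr -ext_mapM -rep_actM mulVg rep_act1 ext_map1.
rewrite scalemxAl hull_mx_local; last exact: levelP.
rewrite -scalemxAl scalemxAr eB -scalemxAr -ext_mapM -rep_actM mulgV rep_act1.
by rewrite ext_map1.
Qed.

Lemma common_level V W : exists i, factors V i /\ factors W i.
Proof.
have [i [Vi Wi]] := I_directed (level V) (level W).
exists i; split; first by apply: factors_le Vi _; exact: levelP.
by apply: factors_le Wi _; exact: levelP.
Qed.

Lemma hull_mx_natural V W (f : 'Hom(V, W)) : rep_hom f ->
  hull_mx x W *m ext_map R f = ext_map R f *m hull_mx x V.
Proof.
move=> fP; have [i [Vi Wi]] := common_level V W.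
apply: (@co_local _ _ _ (x i)) => h.
rewrite scalemxAl hull_mx_local // -scalemxAl scalemxAr.
by rewrite scalemxAr hull_mx_local // -!scalemxAr -!ext_mapM fP.
Qed.

Lemma hull_mx_unit : hull_mx x (rep_unit F G) = 1%:M.
Proof.
apply: (@co_local _ _ _ (x (level (rep_unit F G)))) => h.
by rewrite hull_mx_local ?ext_map1 //; exact: levelP.
Qed.

Lemma hull_mx_tens V W u v :
  hull_mx x (rep_tens V W) *m ext_tens u v =
    ext_tens (hull_mx x V *m u) (hull_mx x W *m v).
Proof.
have [i [Vi Wi]] := common_level V W.
apply: (@co_local _ _ _ (x i)) => h.
rewrite -ext_tensZl !scalemxAl !hull_mx_local //; last exact: factors_tens.
(* By bilinearity the idempotent moves from the first tensor factor to the second, so one copy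
   localizes both. *)
rewrite -!scalemxAl ext_tensZl -ext_tensZr [in RHS]scalemxAl hull_mx_local //.
by rewrite -scalemxAl ext_tensZr ext_map_tens.
Qed.

Definition hull_point : tens_aut G R :=
  TensAut hull_mx_unitmx hull_mx_natural hull_mx_unit hull_mx_tens.
End AutomorphismOfPoint.

(** * The two constructions are mutually inverse *)

Lemma hull_pointM x y :
  hull_point (gf_mul x y) = ta_mul (hull_point x) (hull_point y).
Proof.
apply: tens_aut_ext => V; apply/matrixP => k l.
pose i := level V; rewrite !mxE /= /const_mul_fun.
under [RHS]eq_bigr => m _ do rewrite !mxE !(coE _ (coef _ _ _ _)) mulr_suml.
rewrite [RHS]exchange_big; apply: eq_bigr => g _.
under [RHS]eq_bigr => m _ do rewrite mulr_sumr.
rewrite [RHS]exchange_big; apply: eq_bigr => h _.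
(* The section [s] may fail to be multiplicative, but both elements have component [g * h] at level
   [i], through which [V] factors. *)
rewrite ffunE (@levelP V (s i (g * h)%g) (s i g * s i h)%g); last first.
  by rewrite sK /= !sK.
rewrite rep_actM lmxM mxE scaler_suml; apply: eq_bigr => m _.
by rewrite !ffunE -scalerAl -scalerAr scalerA.
Qed.

Lemma ta_pointK a : hull_point (ta_point a) = a.
Proof.
apply: tens_aut_ext => V; apply/matrixP => k l; rewrite mxE.
pose i := level V.
have cl : linear (fun v : V => [ffun h => coordf k (rep_act V (s i h) v)]
    : {ffun P i -> F^o}).
  by move=> c v w; apply/ffunP => h; rewrite !ffunE !linearP.
(* The matrix coefficients of the [k]-th coordinate form a morphism to the regular representation,
   so [a] commutes with it. *)
pose c : 'Hom(V, reg_rep i) := mk_hom cl.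
have cE v h : c v h = coordf k (rep_act V (s i h) v).
  by rewrite /c mk_homE ffunE.
have cP : rep_hom c.
  move=> g; apply/lfunP => v; apply/ffunP => h; rewrite !comp_lfunE.
  rewrite -[rep_act (reg_rep i)]/(@reg_act i) reg_actE !cE.
  rewrite -(comp_lfunE (rep_act V _)) -rep_actM.
  congr (coordf k _).
  by rewrite (@levelP V _ (s i (h * lim_val g i)%g)) //= !sK.
have -> : coef V i k l = c (vbasis {: V})`_l.
  by apply/ffunP => h; rewrite cE !ffunE coordfE mxE.
rewrite /= /ta_form -ext_map_vec mulmxA (ta_natural a cP) -mulmxA ext_form_map.
(* Evaluation at 1 recovers the [k]-th coordinate, leaving the entry of [a V] at [k], [l]. *)
have -> : (ev1 F (P i) \o c)%VF = coordf k.
  apply/lfunP => v; rewrite comp_lfunE ev1E cE.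
  by rewrite (@levelP V _ 1%g) ?sK // rep_act1 id_lfunE.
by rewrite ext_form_coordf ext_vec_basis -colE mxE.
Qed.

Lemma hull_pointK x : ta_point (hull_point x) = x.
Proof.
apply: gf_lim_ext => i; apply: const_ob_ext => g0.
move: (ffdelta F g0) => f; rewrite /= /ta_form.
(* On the idempotent of [h] the automorphism is right translation by [h]; its value at 1 is [f h],
   which is also the value of [x i] there. *)
apply: (@co_localr _ _ _ (x i)) => h; rewrite co_delta_mul.
have -> (u : 'cV[R]_(\dim {: reg_rep i})) :
    (x i : const_ob (P i) R) (ffdelta F h) * ext_form (ev1 F (P i)) u =
    ext_form (ev1 F (P i)) ((x i : const_ob (P i) R) (ffdelta F h) *: u).
  by rewrite linearZ.
rewrite scalemxAl hull_mx_local; last exact: factors_reg.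
rewrite -scalemxAl linearZ /= ext_map_vec ext_form_vec ev1E.
by rewrite reg_actE sK mul1g; exact: mulr_algr.
Qed.

(** Multiplicativity is transported from [hull_point], where it is an identity of matrix
    products. *)
Lemma ta_pointM a b : ta_point (ta_mul a b) = gf_mul (ta_point a) (ta_point b).
Proof.
by apply: (can_inj hull_pointK); rewrite hull_pointM !ta_pointK.
Qed.
End TannakianPoints.

(** * Naturality, factorization by continuity, and the isomorphism *)

Lemma ta_point_nat (F : fieldType) (d : Order.disp_t) (I : preorderType d)
    (P : I -> finGroupType) (t : inv_system (fun i => P i))
    (R S : comAlgType F) (f : {lrmorphism R -> S})
    (a : tens_aut (profinite t) R) :
  ta_point (ta_map f a) = gf_map f (ta_point a).
Proof.
apply: gf_lim_ext => i; apply: const_ob_ext => g.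
by rewrite /= /ta_form -map_ext_form map_mxM map_ext_vec.
Qed.

(** By continuity the elements acting as the identity include a neighbourhood of 1, hence the kernel
    of some projection; elements with the same component there differ by a member of that kernel. *)
Lemma rep_factors (F : fieldType) (d : Order.disp_t) (I : preorderType d)
    (P : I -> finGroupType) (t : inv_system (fun i => P i))
    (I_inhabited : inhabited I)
    (I_directed : forall i j : I, exists k : I, (i <= k)%O /\ (j <= k)%O)
    (V : rep F (profinite t)) : exists i, factors V i.
Proof.
have [i iV] := profinite_nbhs_base I_inhabited I_directed (rep_near V 1%g).
exists i => g h e; rewrite -[g](mulgVK h) rep_actM iV ?rep_act1 ?comp_lfun1l //.
by rewrite /= e mulgV.
Qed.

Theorem lemma2p6 (F : fieldType) (d : Order.disp_t) (I : preorderType d)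
    (P : I -> finGroupType) (t : inv_system (fun i => P i))
    (I_inhabited : inhabited I)
    (I_directed : forall i j : I, exists k : I, (i <= k)%O /\ (j <= k)%O)
    (t_surjective : forall (i j : I) (le_ij : (i <= j)%O) (y : P i),
      exists x : P j, inv_tr t le_ij x = y) :
  gf_isomorphic (alg_hull F (profinite t)) (gf_lim (const_system F t)).
Proof.
pose s i (h : P i) : profinite t :=
  projT1 (cid (profinite_surj I_inhabited I_directed t_surjective h)).
have sK i h : lim_val (s i h) i = h by rewrite /s; case: cid.
have fac := @rep_factors F d I P t I_inhabited I_directed.
exists (@GfHom F (alg_hull F (profinite t)) (gf_lim (const_system F t))
  (fun R => @ta_point F d I P t R)
  (fun R => ta_pointM (R := R) sK I_directed fac)
  (@ta_point_nat F d I P t)) => R.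
exists (hull_point (R := R) sK I_directed fac).
  exact: ta_pointK.
exact: hull_pointK.
Qed.
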